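(* Let $A$ be a $p$-permutation $G$-algebra and $c$ a primitive idempotent of $A^G$. Let $Q$ be a $p$-subgroup of $G$ and $e$ a block of $A(Q)$. If $e$ is a primitive idempotent of $A(Q)^{C_G(Q,e)}$, then $(Q,e)$ is an $(A,c,G)$-Brauer pair if and only if $\mathrm{Br}_Q^A(c)e=e$.
   Context: $k$ is a field of prime characteristic $p$ (not necessarily algebraically closed), $G$ is a finite group, algebras are finite dimensional over $k$. A $G$-algebra $A$ is a $k$-algebra on which $G$ acts by algebra automorphisms; it is a $p$-permutation $G$-algebra if for every $p$-subgroup $P$ of $G$ it has a $P$-stable $k$-basis. $A^L$ denotes the $L$-fixed elements and $A_K^L$ the image of the relative trace $\mathrm{Tr}_K^L:A^K\to A^L$. For a $p$-subgroup $Q$ of $G$, $A(Q)=A^Q/\sum_{R<Q}A_R^Q$ with quotient map the Brauer homomorphism $\mathrm{Br}_Q^A:A^Q\to A(Q)$; $A(Q)$ is an $N_G(Q)$-algebra. A block of $A(Q)$ is a primitive idempotent of $Z(A(Q))$. $C_G(Q,e)$ is the stabilizer of $e$ in $C_G(Q)$. An $(A,c,G)$-Brauer pair is a pair $(Q,e)$ with $Q$ a $p$-subgroup of $G$ and $e$ a block of $A(Q)$ such that $\mathrm{Br}_Q^A(c)e\neq0$. *)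

(* Defs.v *)
From HB Require Import structures.
From mathcomp Require Import all_boot all_order all_fingroup all_algebra.
From mathcomp Require Import all_solvable all_field.
From mathcomp Require Import generic_quotient ring_quotient.

Set Implicit Arguments.
Unset Strict Implicit.
Unset Printing Implicit Defensive.

Import GroupScope GRing.Theory.
Local Open Scope quotient_scope.
Local Open Scope ring_scope.

(* A falgType is nonzero. The zero algebra is excluded harmlessly: none of its
   fixed subalgebras contains a primitive idempotent. *)
Record galgebra (k : fieldType) (G : finGroupType) := GAlgebra {
  galg_sort :> falgType k;
  galg_act : G -> 'AEnd(galg_sort);
  galg_act1 : galg_act 1%g = \1%AF;
  galg_actM : forall g h : G, galg_act (g * h)%g = (galg_act g \o galg_act h)%AF
}.

Section GAlgebra.
Variables (k : fieldType) (G : finGroupType) (A : galgebra k G).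
Implicit Types (g : G) (H K L P Q : {group G}) (a b : A).

Definition p_permutation (p : nat) : Prop :=
  forall P, p.-group P ->
  exists2 X : seq A, basis_of {:A} X &
    forall g, g \in P -> {in X, forall x, galg_act A g x \in X}.

Definition fixv (L : {set G}) : {vspace A} :=
  (\bigcap_(g in L) fixedSpace (galg_act A g))%VS.

Lemma fixvP (L : {set G}) a :
  reflect (forall g, g \in L -> galg_act A g a = a) (a \in fixv L).
Proof.
rewrite /fixv memvE; apply: (iffP subv_bigcapP) => h g gL.
  by apply/fixedSpaceP; rewrite memvE h.
by rewrite -memvE; apply/fixedSpaceP/h.
Qed.

Lemma fixv_is_aspace (L : {set G}) : is_aspace (fixv L).
Proof.
rewrite /is_aspace has_algid1; last by apply/fixvP => g _; rewrite rmorph1.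
apply/prodvP => a b /fixvP ha /fixvP hb; apply/fixvP => g gL.
by rewrite rmorphM /= ha ?hb.
Qed.
Canonical fixv_aspace (L : {set G}) : {aspace A} := ASpace (fixv_is_aspace L).

Lemma galg_actK g : cancel (galg_act A g) (galg_act A g^-1%g).
Proof.
move=> a; have := congr1 (fun f : 'AEnd(A) => f a) (galg_actM A g^-1%g g).
by rewrite /= mulVg galg_act1 comp_lfunE id_lfunE.
Qed.

Lemma galg_actME g h a : galg_act A (g * h)%g a = galg_act A g (galg_act A h a).
Proof. by rewrite galg_actM comp_lfunE. Qed.

Definition rel_trace (K L : {set G}) : 'End(A) :=
  \sum_(X in lcosets K L) (galg_act A (fingroup.repr X) : 'End(A)).

Definition trace_img (K L : {set G}) : {vspace A} := (rel_trace K L @: fixv K)%VS.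

Lemma rel_traceE K L a :
  rel_trace K L a = \sum_(X in lcosets K L) galg_act A (fingroup.repr X) a.
Proof. by rewrite /rel_trace sum_lfunE. Qed.

Definition brauer_ker (Q : {group G}) : {vspace A} :=
  (\sum_(R : {group G} | R \proper Q) trace_img R Q)%VS.

Lemma fixv_repr_lcoset K (g x : G) a :
  a \in fixv K -> x \in (g *: K)%g ->
  galg_act A (fingroup.repr (g *: K)%g) a = galg_act A x a.
Proof.
move=> /fixvP aK xgK; have : fingroup.repr (g *: K)%g \in (g *: K)%g.
  exact: (mem_repr x).
rewrite -(lcoset_eqP xgK) => /lcosetP[y yK ->].
by rewrite galg_actME aK.
Qed.

Lemma rel_traceMr K L a b : K \subset L -> b \in fixv L ->
  rel_trace K L a * b = rel_trace K L (a * b).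
Proof.
move=> sKL /fixvP bL; rewrite !rel_traceE mulr_suml.
apply: eq_bigr => _ /lcosetsP[x xL ->].
rewrite rmorphM /= [galg_act A _ b]bL //.
have /lcosetP[y yK ->] := mem_repr x (lcoset_refl K x).
by rewrite groupM // (subsetP sKL).
Qed.

Lemma rel_traceMl K L a b : K \subset L -> b \in fixv L ->
  b * rel_trace K L a = rel_trace K L (b * a).
Proof.
move=> sKL /fixvP bL; rewrite !rel_traceE mulr_sumr.
apply: eq_bigr => _ /lcosetsP[x xL ->].
rewrite rmorphM /= [galg_act A _ b]bL //.
have /lcosetP[y yK ->] := mem_repr x (lcoset_refl K x).
by rewrite groupM // (subsetP sKL).
Qed.

Lemma fixvJ (L : {set G}) g a :
  a \in fixv L -> galg_act A g a \in fixv (L :^ g^-1)%g.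
Proof.
move=> /fixvP aL; apply/fixvP => _ /imsetP[x xL ->].
by rewrite -galg_actME conjgE invgK mulgA mulgKV galg_actME aL.
Qed.

Lemma rel_traceJ K L g a : a \in fixv K ->
  galg_act A g (rel_trace K L a)
  = rel_trace (K :^ g^-1)%g (L :^ g^-1)%g (galg_act A g a).
Proof.
move=> aK; rewrite !rel_traceE linear_sum /=.
have -> : lcosets (K :^ g^-1)%g (L :^ g^-1)%g
        = [set (X :^ g^-1)%g | X : {set G} in lcosets K L].
  apply/setP => Y; apply/lcosetsP/imsetP.
    move=> [_ /imsetP[x xL ->] ->]; exists (x *: K)%g.
      by apply/lcosetsP; exists x.
    by rewrite conjsMg conjg_set1.
  move=> [_ /lcosetsP[x xL ->] ->]; exists (x ^ g^-1)%g; first exact: imset_f.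
  by rewrite conjsMg conjg_set1.
rewrite (big_imset _ (in2W (@conjsg_inj G g^-1%g))) /=.
apply: eq_bigr => _ /lcosetsP[x xL ->].
rewrite (fixv_repr_lcoset aK (lcoset_refl _ _)).
have -> : ((x *: K) :^ g^-1 = (x ^ g^-1) *: (K :^ g^-1)%G)%g.
  by rewrite conjsMg conjg_set1.
rewrite (fixv_repr_lcoset (fixvJ g aK) (lcoset_refl _ _)).
by rewrite -!galg_actME conjgE invgK mulgA mulgKV.
Qed.

Lemma brauer_ker_ind Q (V : {vspace A}) :
  (forall (R : {group G}) a, R \proper Q -> a \in fixv R -> rel_trace R Q a \in V) ->
  (brauer_ker Q <= V)%VS.
Proof.
move=> h; apply/subv_sumP => R RQ; apply/subvP => _ /memv_imgP[a aR ->].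
exact: h.
Qed.

Lemma rel_trace_ker Q (R : {group G}) a :
  R \proper Q -> a \in fixv R -> rel_trace R Q a \in brauer_ker Q.
Proof.
move=> RQ aR; apply: (subvP (sumv_sup R RQ (subvv _))).
exact: memv_img.
Qed.

Lemma fixvM (L : {set G}) a b :
  a \in fixv L -> b \in fixv L -> a * b \in fixv L.
Proof.
by move=> /fixvP aL /fixvP bL; apply/fixvP => g gL; rewrite rmorphM /= aL ?bL.
Qed.

Lemma fixvS (K L : {set G}) : K \subset L -> (fixv L <= fixv K)%VS.
Proof.
move=> /subsetP sKL; apply/subvP => a /fixvP aL.
by apply/fixvP => g /sKL/aL.
Qed.

Lemma brauer_kerMr Q a b :
  a \in brauer_ker Q -> b \in fixv Q -> a * b \in brauer_ker Q.
Proof.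
move=> aI bQ; have -> : a * b = amulr b a by rewrite lfunE.
rewrite memv_preim; move: a aI; apply/subvP/brauer_ker_ind => R a RQ aR.
have sRQ := proper_sub RQ; rewrite -memv_preim lfunE /= rel_traceMr //.
by rewrite rel_trace_ker // fixvM // (subvP (fixvS sRQ)).
Qed.

Lemma brauer_kerMl Q a b :
  a \in brauer_ker Q -> b \in fixv Q -> b * a \in brauer_ker Q.
Proof.
move=> aI bQ; have -> : b * a = amull b a by rewrite lfunE.
rewrite memv_preim; move: a aI; apply/subvP/brauer_ker_ind => R a RQ aR.
have sRQ := proper_sub RQ; rewrite -memv_preim lfunE /= rel_traceMl //.
by rewrite rel_trace_ker // fixvM // (subvP (fixvS sRQ)).
Qed.

Lemma fixv_norm Q g a :
  g \in 'N(Q)%g -> a \in fixv Q -> galg_act A g a \in fixv Q.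
Proof. by rewrite -groupV => /normP {2}<- /(fixvJ g). Qed.

Lemma brauer_ker_norm Q g a :
  g \in 'N(Q)%g -> a \in brauer_ker Q -> galg_act A g a \in brauer_ker Q.
Proof.
rewrite -groupV => nQ aI; rewrite memv_preim; move: a aI.
apply/subvP/brauer_ker_ind => R a RQ aR.
rewrite -memv_preim rel_traceJ // (normP nQ).
have -> : (R :^ g^-1)%g = (R :^ g^-1)%G by [].
apply: rel_trace_ker; last exact: fixvJ.
by rewrite /= -(normP nQ) properJ.
Qed.

End GAlgebra.

Section BrauerQuotient.
Variables (k : fieldType) (G : finGroupType) (A : galgebra k G).
Variable Q : {group G}.

Local Notation AQ := (subvs_of (fixv_aspace A Q)).
Implicit Types (u v : AQ).

Definition brauer_ideal : AQ -> bool := fun u => vsval u \in brauer_ker A Q.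

Lemma brauer_ideal_zmod : zmod_closed brauer_ideal.
Proof.
split=> [|u v]; rewrite /in_mem /= /brauer_ideal ?linear0 ?mem0v // linearB.
exact: memvB.
Qed.
HB.instance Definition _ :=
  GRing.isZmodClosed.Build AQ brauer_ideal brauer_ideal_zmod.

Definition brauer_quot := {ideal_quot (GRing.ZmodClosed.clone AQ brauer_ideal _)}.
HB.instance Definition _ := GRing.Zmodule.on brauer_quot.
HB.instance Definition _ := Quotient.on brauer_quot.

Definition brauer_pi (u : AQ) : brauer_quot := \pi_brauer_quot u.
Definition brauer_lift (x : brauer_quot) : AQ := generic_quotient.repr x.

Lemma brauer_liftK : cancel brauer_lift brauer_pi.
Proof. by move=> x; rewrite /brauer_pi /brauer_lift reprK. Qed.

Lemma brauer_piP u v :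
  reflect (brauer_pi u = brauer_pi v) (vsval (u - v) \in brauer_ker A Q).
Proof.
have -> : (vsval (u - v) \in brauer_ker A Q) = (u - v \in brauer_ideal) by [].
by rewrite Quotient.idealrBE; apply: eqP.
Qed.

Lemma brauer_pi_is_zmod_morphism : zmod_morphism brauer_pi.
Proof. by move=> u v; rewrite /brauer_pi raddfB. Qed.
HB.instance Definition _ :=
  GRing.isZmodMorphism.Build AQ brauer_quot brauer_pi brauer_pi_is_zmod_morphism.

Lemma brauer_lift_pi u : vsval (brauer_lift (brauer_pi u) - u) \in brauer_ker A Q.
Proof. by apply/brauer_piP; rewrite brauer_liftK. Qed.

Definition brauer_one : brauer_quot := brauer_pi 1.
Definition brauer_mul (x y : brauer_quot) : brauer_quot :=
  brauer_pi (brauer_lift x * brauer_lift y).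
Definition brauer_scale (a : k) (x : brauer_quot) : brauer_quot :=
  brauer_pi (a *: brauer_lift x).

Lemma brauer_pi_mul u v : brauer_mul (brauer_pi u) (brauer_pi v) = brauer_pi (u * v).
Proof.
apply/brauer_piP; set u' := brauer_lift _; set v' := brauer_lift _.
have -> : u' * v' - u * v = (u' - u) * v' + u * (v' - v).
  by rewrite mulrBl mulrBr addrA subrK.
rewrite linearD memvD //.
  by apply: brauer_kerMr; [apply: brauer_lift_pi | apply: subvsP].
by apply: brauer_kerMl; [apply: brauer_lift_pi | apply: subvsP].
Qed.

Lemma brauer_pi_scale a u : brauer_scale a (brauer_pi u) = brauer_pi (a *: u).
Proof.
by apply/brauer_piP; rewrite -scalerBr linearZ memvZ // brauer_lift_pi.
Qed.

Lemma brauer_ind (P : brauer_quot -> Prop) :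
  (forall u, P (brauer_pi u)) -> forall x, P x.
Proof. by move=> h x; rewrite -(brauer_liftK x). Qed.

Lemma brauer_mulA : associative brauer_mul.
Proof.
move=> x y z; elim/brauer_ind: x => u; elim/brauer_ind: y => v.
by elim/brauer_ind: z => w; rewrite !brauer_pi_mul mulrA.
Qed.

Lemma brauer_mul1 : left_id brauer_one brauer_mul.
Proof. by move=> x; elim/brauer_ind: x => u; rewrite brauer_pi_mul mul1r. Qed.

Lemma brauer_mulr1 : right_id brauer_one brauer_mul.
Proof. by move=> x; elim/brauer_ind: x => u; rewrite brauer_pi_mul mulr1. Qed.

Lemma brauer_mulDl : left_distributive brauer_mul +%R.
Proof.
move=> x y z; elim/brauer_ind: x => u; elim/brauer_ind: y => v.
by elim/brauer_ind: z => w; rewrite -raddfD !brauer_pi_mul mulrDl raddfD.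
Qed.

Lemma brauer_mulDr : right_distributive brauer_mul +%R.
Proof.
move=> x y z; elim/brauer_ind: x => u; elim/brauer_ind: y => v.
by elim/brauer_ind: z => w; rewrite -raddfD !brauer_pi_mul mulrDr raddfD.
Qed.

(* MathComp's algebra structures require 1 != 0, which fails when A(Q) = 0;
   hence pzRingType together with lmodType. *)
HB.instance Definition _ := GRing.Zmodule_isPzRing.Build brauer_quot
  brauer_mulA brauer_mul1 brauer_mulr1 brauer_mulDl brauer_mulDr.

Lemma brauer_pi_is_monoid_morphism : monoid_morphism brauer_pi.
Proof. by split=> [|u v] //; rewrite -brauer_pi_mul. Qed.
HB.instance Definition _ :=
  GRing.isMonoidMorphism.Build AQ brauer_quot brauer_pi brauer_pi_is_monoid_morphism.

Lemma brauer_scaleA a b x :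
  brauer_scale a (brauer_scale b x) = brauer_scale (a * b) x.
Proof. by elim/brauer_ind: x => u; rewrite !brauer_pi_scale scalerA. Qed.

Lemma brauer_scale1 : left_id 1 brauer_scale.
Proof. by move=> x; elim/brauer_ind: x => u; rewrite brauer_pi_scale scale1r. Qed.

Lemma brauer_scaleDr : right_distributive brauer_scale +%R.
Proof.
move=> a x y; elim/brauer_ind: x => u; elim/brauer_ind: y => v.
by rewrite -raddfD !brauer_pi_scale scalerDr raddfD.
Qed.

Lemma brauer_scaleDl x : {morph brauer_scale^~ x : a b / a + b}.
Proof.
by move=> a b; elim/brauer_ind: x => u; rewrite !brauer_pi_scale scalerDl raddfD.
Qed.

HB.instance Definition _ := GRing.Zmodule_isLmodule.Build k brauer_quot
  brauer_scaleA brauer_scale1 brauer_scaleDr brauer_scaleDl.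

Lemma brauer_pi_is_scalable : scalable brauer_pi.
Proof. by move=> a u; rewrite -brauer_pi_scale. Qed.
HB.instance Definition _ :=
  GRing.isScalable.Build k AQ brauer_quot *:%R brauer_pi brauer_pi_is_scalable.

Lemma brauer_scaleAl a (x y : brauer_quot) : a *: (x * y) = (a *: x) * y.
Proof.
elim/brauer_ind: x => u; elim/brauer_ind: y => v.
have piZ w : a *: brauer_pi w = brauer_pi (a *: w) by rewrite linearZ.
by rewrite piZ -!rmorphM piZ /= scalerAl.
Qed.

Lemma brauer_scaleAr a (x y : brauer_quot) : a *: (x * y) = x * (a *: y).
Proof.
elim/brauer_ind: x => u; elim/brauer_ind: y => v.
have piZ w : a *: brauer_pi w = brauer_pi (a *: w) by rewrite linearZ.
by rewrite piZ -!rmorphM piZ /= scalerAr.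
Qed.

(* The Brauer homomorphism, meaningful on A^Q only. *)
Definition Br (a : A) : brauer_quot := brauer_pi (vsproj (fixv_aspace A Q) a).

(* The action of 'N(Q) on A(Q); junk for g outside 'N(Q). *)
Definition brauer_act (g : G) (x : brauer_quot) : brauer_quot :=
  Br (galg_act A g (vsval (brauer_lift x))).

Lemma Br_eq0 a : a \in fixv A Q -> (Br a == 0) = (a \in brauer_ker A Q).
Proof.
move=> aQ; rewrite /Br -(raddf0 brauer_pi).
by apply/eqP/idP => [/brauer_piP|aI]; rewrite ?subr0 ?vsprojK //;
  apply/brauer_piP; rewrite subr0 vsprojK.
Qed.

Lemma brauer_actE g a : g \in 'N(Q)%g -> a \in fixv A Q ->
  brauer_act g (Br a) = Br (galg_act A g a).
Proof.
move=> nQ aQ; apply/brauer_piP; rewrite linearB /=.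
have h := brauer_lift_pi (vsproj (fixv_aspace A Q) a).
rewrite !vsprojK ?fixv_norm ?subvsP // -linearB brauer_ker_norm //.
by rewrite linearB /= vsprojK in h.
Qed.

Lemma Br_surj (x : brauer_quot) : exists2 a, a \in fixv A Q & x = Br a.
Proof.
by exists (vsval (brauer_lift x)); rewrite ?subvsP // /Br vsvalK brauer_liftK.
Qed.

Lemma BrM a b :
  a \in fixv A Q -> b \in fixv A Q -> Br (a * b) = Br a * Br b.
Proof.
move=> aQ bQ; rewrite /Br -rmorphM; congr brauer_pi; apply: subvs_inj.
by rewrite vsprojK ?fixvM //= !vsprojK.
Qed.

Lemma brauer_act_mul g x y : g \in 'N(Q)%g ->
  brauer_act g (x * y) = brauer_act g x * brauer_act g y.
Proof.
move=> nQ; have [a aQ ->] := Br_surj x; have [b bQ ->] := Br_surj y.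
by rewrite -BrM // !brauer_actE ?fixvM // rmorphM BrM ?fixv_norm.
Qed.

Lemma brauer_act_linear g : g \in 'N(Q)%g -> linear (brauer_act g).
Proof.
move=> nQ t x y; have [a aQ ->] := Br_surj x; have [b bQ ->] := Br_surj y.
have -> : t *: Br a + Br b = Br (t *: a + b) by rewrite /Br !linearP.
by rewrite !brauer_actE // ?memvD ?memvZ // linearP /Br !linearP.
Qed.

Lemma brauer_actME g h x : g \in 'N(Q)%g -> h \in 'N(Q)%g ->
  brauer_act (g * h)%g x = brauer_act g (brauer_act h x).
Proof.
move=> nQg nQh; have [a aQ ->] := Br_surj x.
by rewrite !brauer_actE ?groupM ?fixv_norm // galg_actME.
Qed.

Lemma brauer_act1 x : brauer_act 1%g x = x.
Proof.
by have [a aQ ->] := Br_surj x; rewrite brauer_actE // galg_act1 id_lfunE.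
Qed.

End BrauerQuotient.

Section PrimitiveIdempotent.
Variables (R : pzRingType) (S : R -> Prop).

Definition primitive_idempotent (e : R) : Prop :=
  [/\ S e, e * e = e, e != 0 &
      forall f h : R, S f -> S h -> f * f = f -> h * h = h ->
        f * h = 0 -> h * f = 0 -> e = f + h -> f = 0 \/ h = 0].

End PrimitiveIdempotent.

Definition in_center (R : pzRingType) (z : R) : Prop := forall x : R, z * x = x * z.

Section BrauerPair.
Variables (k : fieldType) (G : finGroupType) (A : galgebra k G).

Definition block (Q : {group G}) (e : brauer_quot A Q) : Prop :=
  primitive_idempotent (@in_center (brauer_quot A Q)) e.

Definition cent_stab (Q : {group G}) (e : brauer_quot A Q) : {set G} :=
  [set g in 'C(Q)%g | brauer_act g e == e].

Definition brauer_fix (Q : {group G}) (L : {set G}) (x : brauer_quot A Q) : Prop :=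
  forall g, g \in L -> brauer_act g x = x.

Definition brauer_pair (p : nat) (c : A) (Q : {group G}) (e : brauer_quot A Q) : Prop :=
  [/\ p.-group Q, block e & Br Q c * e != 0].

End BrauerPair.

(* Main.v *)
Require Import Defs.
From mathcomp Require Import all_boot all_order all_fingroup all_algebra.
From mathcomp Require Import all_solvable all_field.

Import GRing.Theory.
Local Open Scope ring_scope.

(** Since [e] is central in A(Q), the idempotent [Br Q c] splits it as [Br Q c * e] plus
    [e - Br Q c * e]. Both summands are fixed by C_G(Q,e), because [c] is G-fixed and this
    stabilizer normalizes Q ([brauer_fix_Br]). Primitivity of [e] among fixed elements then forces
    [Br Q c * e] to be 0 or [e] ([primitive_idempotent_comm]), and the pair condition excludes 0.
    Conversely, [Br Q c * e = e] is nonzero because [e] is. *)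

Lemma primitive_idempotent_comm (R : pzRingType) (S : R -> Prop) (b e : R) :
  primitive_idempotent S e -> b * b = b -> GRing.comm b e ->
  S (b * e) -> S (e - b * e) -> b * e = 0 \/ b * e = e.
Proof.
move=> [_ ee _ prim_e] bb cbe Sbe Sebe.
(* As [b] commutes with [e], the product [b * e] absorbs [e] on both sides, so it and [e - b * e]
   are orthogonal idempotents with sum [e]. *)
have e_be : e * (b * e) = b * e by rewrite mulrA -cbe -mulrA ee.
have be_e : b * e * e = b * e by rewrite -mulrA ee.
have be_be : b * e * (b * e) = b * e by rewrite -mulrA e_be mulrA bb.
have orth_l : b * e * (e - b * e) = 0 by rewrite mulrBr be_e be_be subrr.
have orth_r : (e - b * e) * (b * e) = 0 by rewrite mulrBl e_be be_be subrr.
have idem : (e - b * e) * (e - b * e) = e - b * e.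
  by rewrite mulrBr orth_r subr0 mulrBl ee be_e.
have [||/eqP] := prim_e _ _ Sbe Sebe be_be idem orth_l orth_r; last 2 first.
- by left.
- by rewrite subr_eq0 => /eqP <-; right.
by rewrite addrC subrK.
Qed.

(** On the normalizer of Q, [brauer_act] is induced by the action on A, which fixes [c]; outside it
    [brauer_act] is junk, hence the condition on [L]. *)
Lemma brauer_fix_Br (k : fieldType) (G : finGroupType) (A : galgebra k G)
    (Q : {group G}) (L : {set G}) (c : A) :
  L \subset 'N(Q)%g -> c \in fixv A [set: G] -> brauer_fix L (Br Q c).
Proof.
move=> /subsetP nQL cG g /nQL nQg; rewrite brauer_actE //.
  by move/fixvP: cG => ->.
exact: subvP (fixvS A (subsetT Q)) _ cG.
Qed.

Theorem proposition2p2 (k : fieldType) (p : nat) (G : finGroupType)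
  (A : galgebra k G) (c : A) (Q : {group G}) (e : brauer_quot A Q)
  (char_k : p \in [pchar k])
  (A_pperm : p_permutation A p)
  (c_prim : primitive_idempotent (fun a : A => a \in fixv A [set: G]) c)
  (Q_pgroup : (p.-group Q)%g)
  (e_block : block e)
  (e_prim : primitive_idempotent (brauer_fix (cent_stab e)) e) :
  brauer_pair p c e <-> Br Q c * e = e.
Proof.
have [cG cc _ _] := c_prim; have [e_fix _ e_neq0 _] := e_prim.
have [e_central _ _ _] := e_block.
split=> [[_ _ ce_neq0]|ce]; last by split; rewrite ?ce.
(* [Br] is multiplicative on A^Q only; with [c] there, [Br Q c] is idempotent. *)
have cQ : c \in fixv A Q := subvP (fixvS A (subsetT Q)) _ cG.
have nQL : cent_stab e \subset 'N(Q)%g.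
  by apply/subsetP => g; rewrite inE => /andP[/(subsetP (cent_sub _))].
have ce_fix : brauer_fix (cent_stab e) (Br Q c * e).
  move=> g gL; rewrite brauer_act_mul ?(subsetP nQL) // e_fix //.
  by rewrite (brauer_fix_Br _ _ _ _ _ _ nQL cG).
have ece_fix : brauer_fix (cent_stab e) (e - Br Q c * e).
  move=> g gL; have nQg := subsetP nQL g gL.
  (* The difference is read as a combination with scalar -1, the shape in which linearity of
     [brauer_act g] is stated. *)
  have := brauer_act_linear nQg (-1) (Br Q c * e) e.
  by rewrite !scaleN1r ce_fix // e_fix // ![- _ + _]addrC.
have bb : Br Q c * Br Q c = Br Q c by rewrite -BrM ?cc.
have [ce0|//] := primitive_idempotent_comm _ _ _ _ e_prim bb
  (esym (e_central _)) ce_fix ece_fix.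
by rewrite ce0 eqxx in ce_neq0.
Qed.
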